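(* (Costly communication.) The optimal policy $f^\star$ for Problem 1, i.e. for $\inf_{f\in\mathbb F}J_e(f)+\lambda J_r(f)$, with known channel condition $r_s$ is of threshold type, i.e., there exists a constant $\theta^\star\in\mathbb S$ such that $$f^\star(\tau)=\begin{cases}0,&\text{if }\tau<\theta^\star,\\ 1,&\text{if }\tau\ge\theta^\star.\end{cases}$$
   Context: System: $x(k+1)=Ax(k)+w(k)$, $y(k)=Cx(k)+v(k)$, $x(k)\in\mathbb R^n$, $y(k)\in\mathbb R^m$, with mutually independent $w(k)\sim\mathcal N(0,\Sigma_w)$, $v(k)\sim\mathcal N(0,\Sigma_v)$, $x(0)\sim\mathcal N(0,\Pi)$; $\Sigma_w,\Pi$ positive semidefinite, $\Sigma_v$ positive definite, $(A,C)$ detectable, $(A,\sqrt{\Sigma_w})$ stabilizable. A sensor runs a Kalman filter, assumed to be in steady state, and $\overline P$ is its steady-state estimation error covariance. The sensor may send its local estimate over a packet-dropping channel to a remote estimator. If $\tau$ is the time elapsed since the last successful transmission, the remote estimation error covariance is $P(0)=\overline P$ and $P(\tau)=A^\tau\overline P(A^\top)^\tau+\sum_{t=0}^{\tau-1}A^t\Sigma_w(A^\top)^t$ for $\tau\ge1$. Scheduling: the state is $\tau(k)\in\mathbb S=\mathbb N=\{0,1,2,\dots\}$, with $\tau(0)=0$; the action is $a(k)\in\{0,1\}$ ($1$ = transmit). The channel condition $r_s$ is the probability that a transmission succeeds (transmissions succeed independently): under $a=1$ the state moves from $\tau$ to $0$ with probability $r_s$ and to $\tau+1$ with probability $1-r_s$;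 under $a=0$ it moves to $\tau+1$ with probability $1$. An admissible policy $f=\{f_k\}_{k\ge0}$ is a sequence of mappings from the history to the decision, $a(k)=f_k(\tau(0),\dots,\tau(k),a(0),\dots,a(k-1))$; $\mathbb F$ is the set of all admissible policies. A stationary policy is written $a(k)=f(\tau(k))$. The expected average estimation error and the expected average transmission rate are $$J_e(f)=\limsup_{T\to\infty}\tfrac1T\,\mathbb E^f\Big[\sum_{k=0}^{T-1}\operatorname{Tr}P(\tau(k))\Big|\tau(0)=0\Big],\qquad J_r(f)=\limsup_{T\to\infty}\tfrac1T\,\mathbb E^f\Big[\sum_{k=0}^{T-1}a(k)\Big|\tau(0)=0\Big].$$ The given number $\lambda$ is the communication cost for one transmission.
   Formalization: When A is Schur stable, it is additionally assumed that never transmitting is not optimal; otherwise (e.g. A=1/2 and large λ) never transmitting beats every finite threshold and no θ* in 𝕊 exists. *)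

(* Defs.v *)
From HB Require Import structures.
From mathcomp Require Import all_boot all_order all_algebra.
From mathcomp Require Import all_classical all_reals all_analysis.
From mathcomp Require Import complex.

Set Implicit Arguments.
Unset Strict Implicit.
Unset Printing Implicit Defensive.

Import Order.TTheory GRing.Theory Num.Theory.
Import numFieldNormedType.Exports.

Local Open Scope classical_set_scope.
Local Open Scope ring_scope.

Section LinearSystem.
Context {R : realType}.

Definition psd n (S : 'M[R]_n) : Prop :=
  S^T = S /\ forall x : 'rV[R]_n, 0 <= (x *m S *m x^T) 0 0.

Definition pd n (S : 'M[R]_n) : Prop :=
  S^T = S /\ forall x : 'rV[R]_n, x != 0 -> 0 < (x *m S *m x^T) 0 0.

(* The principal square root; it is uniquely determined by [S]. *)
Definition is_sqrtmx n (Q S : 'M[R]_n) : Prop := psd Q /\ Q *m Q = S.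

(* Spectral radius < 1: the eigenvalues are those over the complex field. *)
Definition schur_stable n (A : 'M[R]_n) : Prop :=
  forall z : R[i], eigenvalue (map_mx (real_complex R) A) z -> `|z| < 1.

Definition stabilizable n p (A : 'M[R]_n) (B : 'M[R]_(n, p)) : Prop :=
  exists K : 'M[R]_(p, n), schur_stable (A + B *m K).

Definition detectable n m (A : 'M[R]_n) (C : 'M[R]_(m, n)) : Prop :=
  exists L : 'M[R]_(n, m), schur_stable (A + L *m C).

Definition kf_predict n (A Sw X : 'M[R]_n) : 'M[R]_n := A *m X *m A^T + Sw.

Definition kf_update n m (C : 'M[R]_(m, n)) (Sv : 'M[R]_m) (X : 'M[R]_n) :
    'M[R]_n :=
  X - X *m C^T *m invmx (C *m X *m C^T + Sv) *m C *m X.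

(* Covariance of x(k) - E[x(k) | y(0), ..., y(k)] (a posteriori), started from
   the prior covariance Pi0 of x(0). *)
Fixpoint kf_cov n m (A : 'M[R]_n) (C : 'M[R]_(m, n)) (Sw : 'M[R]_n)
    (Sv : 'M[R]_m) (Pi0 : 'M[R]_n) (k : nat) : 'M[R]_n :=
  if k is k'.+1
  then kf_update C Sv (kf_predict A Sw (kf_cov A C Sw Sv Pi0 k'))
  else kf_update C Sv Pi0.

Definition steady_state_cov n m (A : 'M[R]_n) (C : 'M[R]_(m, n))
    (Sw : 'M[R]_n) (Sv : 'M[R]_m) (Pi0 Pbar : 'M[R]_n) : Prop :=
  kf_cov A C Sw Sv Pi0 @ \oo --> Pbar.

(* For tau = 0 the sum is empty and this is Pbar. *)
Definition remote_cov n (A Sw Pbar : 'M[R]_n) (tau : nat) : 'M[R]_n :=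
  A ^+ tau *m Pbar *m (A^T) ^+ tau
  + \sum_(t < tau) A ^+ t *m Sw *m (A^T) ^+ t.

End LinearSystem.

(* f k (tau(0), ..., tau(k)) (a(0), ..., a(k-1)); true means transmit. *)
Definition policy : Type :=
  forall k : nat, k.+1.-tuple nat -> k.-tuple bool -> bool.

Definition stationary (g : nat -> bool) : policy :=
  fun k taus _ => g (last 0%N taus).

Definition threshold (theta : nat) : policy :=
  stationary (fun tau => (theta <= tau)%N).

Definition never_transmit : policy := stationary (fun _ => false).

(* [gam k] tells whether a transmission made at time k gets through. *)
Fixpoint history (f : policy) (gam : nat -> bool) (k : nat) :
    k.+1.-tuple nat * k.-tuple bool :=
  if k is k'.+1 then
    let h := history f gam k' in
    let a := f k' h.1 h.2 in
    (rcons_tuple h.1 (if a && gam k' then 0%N else (last 0%N h.1).+1),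
     rcons_tuple h.2 a)
  else ([tuple 0%N], [tuple]).

Definition tau_at (f : policy) (gam : nat -> bool) (k : nat) : nat :=
  last 0%N (history f gam k).1.

Definition action_at (f : policy) (gam : nat -> bool) (k : nat) : bool :=
  f k (history f gam k).1 (history f gam k).2.

Section Scheduling.
Context {R : realType} {d : measure_display} {Omega : measurableType d}.
Variable P : probability Omega R.

Definition mutually_independent (X : nat -> {RV P >-> bool}) : Prop :=
  forall (J : seq nat) (B : nat -> set bool), uniq J ->
    P (\bigcap_(k in [set` J]) (X k @^-1` B k))
    = (\prod_(k <- J) P (X k @^-1` B k))%E.

(* The channel outcomes are i.i.d. Bernoulli(r). For the processes [tau_at] and
   [action_at] this yields the controlled Markov chain in which, under action 1,
   tau moves to 0 with probability r and to tau + 1 with probability 1 - r,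
   independently of the past. *)
Definition channel (r : R) (gamma : nat -> {RV P >-> bool}) : Prop :=
  mutually_independent gamma /\
  forall k, P (gamma k @^-1` [set true]) = r%:E.

Variable gamma : nat -> {RV P >-> bool}.

(* The term T = 0 is irrelevant to the upper limits. *)
Definition J_e (cost : nat -> R) (f : policy) : \bar R :=
  limn_esup (fun T : nat => (T%:R^-1)%:E *
    'E_P[fun w => (\sum_(k < T) cost (tau_at f (fun i => gamma i w) k))%R])%E.

Definition J_r (f : policy) : \bar R :=
  limn_esup (fun T : nat => (T%:R^-1)%:E *
    'E_P[fun w => (\sum_(k < T) (action_at f (fun i => gamma i w) k)%:R)%R])%E.

Definition costly_objective (cost : nat -> R) (lambda : R) (f : policy) :
    \bar R :=
  (J_e cost f + lambda%:E * J_r f)%E.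

Definition optimal (cost : nat -> R) (lambda : R) (f : policy) : Prop :=
  costly_objective cost lambda f
  = ereal_inf (range (costly_objective cost lambda)).

End Scheduling.

(* Main.v *)
Require Import Defs.
From HB Require Import structures.
From mathcomp Require Import all_boot all_order all_algebra.
From mathcomp Require Import all_classical all_reals all_analysis.
From mathcomp Require Import complex.
From mathcomp Require Import ring lra zify.

Import Order.TTheory GRing.Theory Num.Theory.
Import numFieldNormedType.Exports.

Local Open Scope classical_set_scope.
Local Open Scope ring_scope.

(* Write c(t) = Tr P(t) and q = 1 - r. Since the steady-state covariance
   satisfies Pbar <= A Pbar A^T + Sw, the cost c is nondecreasing. If lambda <= 0,
   transmitting always is optimal. If lambda >= 0, the renewal argument for the
   threshold policy theta gives the average cost
     J(theta) = (sum_(i < theta) c(i) + sum_j q^j c(theta + j) + lambda / r)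
                / (theta + 1 / r).
   Conversely, if g < J(theta) for every theta, then a bounded h satisfying the
   dynamic programming inequality with constant g can be written down, so every
   policy costs at least g. As soon as some policy does better than sup c, only
   finitely many theta compete, and the best of them is optimal. Such a policy
   exists: if A is Schur stable, one that beats never transmitting; otherwise c
   is unbounded, so any policy of finite cost (if all are infinite, all are
   optimal). *)

(** * Expectations over finitely many channel outcomes *)

Definition upd {T : Type} (s : nat -> T) (k : nat) (b : T) : nat -> T :=
  fun i => if i == k then b else s i.

(** Mean over [k] independent Bernoulli(r) bits, the last one averaged first. Bits from [k] on are
    set to false, which is harmless for functions of the earlier bits. *)
Fixpoint bit_mean {R : realType} (r : R) (k : nat) (G : (nat -> bool) -> R) : R :=
  if k is k'.+1 then
    bit_mean r k' (fun s => r * G (upd s k' true) + (1 - r) * G (upd s k' false))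
  else G (fun _ => false).

Definition depends_below {T : Type} (k : nat) (G : (nat -> bool) -> T) : Prop :=
  forall s s', (forall i, (i < k)%N -> s i = s' i) -> G s = G s'.

Lemma bit_mean_lin {R : realType} (r : R) k (a b : R) F F' :
  bit_mean r k (fun s => a * F s + b * F' s)
  = a * bit_mean r k F + b * bit_mean r k F'.
Proof.
elim: k F F' => //= k IH F F'; rewrite -IH; congr bit_mean.
by apply/funext => s; ring.
Qed.

Lemma bit_mean_cst {R : realType} (r : R) k (a : R) :
  bit_mean r k (fun=> a) = a.
Proof.
elim: k => //= k; congr (_ = _); congr bit_mean.
by apply/funext => s; ring.
Qed.

Lemma ler_bit_mean {R : realType} (r : R) k F F' : 0 <= r <= 1 ->
  (forall s, F s <= F' s) -> bit_mean r k F <= bit_mean r k F'.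
Proof.
move=> /andP[r0 r1]; elim: k F F' => //= k IH F F' FF'; apply: IH => s.
by apply: lerD; apply: ler_wpM2l => //; rewrite subr_ge0.
Qed.

Lemma depends_upd {T : Type} (k : nat) (G : (nat -> bool) -> T) b :
  depends_below k.+1 G -> depends_below k (fun s => G (upd s k b)).
Proof.
move=> dG s s' ss'; apply: dG => i; rewrite ltnS leq_eqVlt /upd.
by case: eqP => //= _; exact: ss'.
Qed.

Section Expectation.
Context {R : realType} {d : measure_display} {Omega : measurableType d}.
Variable P : probability Omega R.
Variables (r : R) (gamma : nat -> {RV P >-> bool}).
Hypothesis hgamma : channel r gamma.

Let cyl (J : seq nat) (B : nat -> set bool) : set Omega :=
  \bigcap_(k in [set` J]) (gamma k @^-1` B k).

Let measurable_cyl J B : measurable (cyl J B).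
Proof.
apply: bigcap_measurableType => //.
move=> k _; rewrite -[X in measurable X]setTI.
exact: (measurable_funPT (gamma k)).
Qed.

Let gamma_false k : P (gamma k @^-1` [set false]) = (1 - r)%:E.
Proof.
have [_ /(_ k) h] := hgamma.
have -> : gamma k @^-1` [set false] = ~` (gamma k @^-1` [set true]).
  by apply/seteqP; split=> w /=; case: (gamma k w).
rewrite probability_setC ?h ?EFinB // -[X in measurable X]setTI.
exact: (measurable_funPT (gamma k)).
Qed.

Let gammaE k (b : bool) :
  P (gamma k @^-1` [set b]) = (if b then r else 1 - r)%:E.
Proof. by case: b; [case: hgamma|]. Qed.

(** Independence, applied to [k :: J] and to [J], splits off the factor of time [k]. *)
Let prob_cyl_cons k J B (b : bool) : uniq J -> k \notin J ->
  P (cyl (k :: J) (upd B k [set b]))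
  = ((if b then r else 1 - r)%:E * P (cyl J B))%E.
Proof.
move=> uJ kJ; have [hind _] := hgamma.
rewrite !hind /= ?kJ // big_cons {1}/upd eqxx gammaE.
congr (_ * _)%E; apply: eq_big_seq => j jJ.
by rewrite /upd; case: eqP => // jk; rewrite -jk jJ in kJ.
Qed.

Let cyl_cons k J B (b : bool) w : k \notin J ->
  \1_(cyl (k :: J) (upd B k [set b])) w
  = (gamma k w == b)%:R * \1_(cyl J B) w :> R.
Proof.
move=> kJ; rewrite !indicE -natrM mulnb; congr (nat_of_bool _)%:R.
apply/idP/andP; rewrite !inE.
  move=> h; split.
    by have := h k; rewrite /upd eqxx /= inE eqxx => /(_ isT) ->.
  move=> j /= jJ; have := h j; rewrite /= inE jJ orbT => /(_ isT).
  by rewrite /upd; case: eqP => // jk; rewrite -jk jJ in kJ.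
move=> [/eqP gk h] j; rewrite /= inE /upd.
by case: eqP => [-> _ //|_ /= jJ]; exact: h.
Qed.

(* The product over outcomes at times >= k is what makes the induction work. *)
Let mean_cyl k G J B : depends_below k G -> uniq J ->
    (forall j, j \in J -> (k <= j)%N) ->
  P.-integrable setT (fun w => (G (gamma ^~ w) * \1_(cyl J B) w)%:E) /\
  (\int[P]_w (G (gamma ^~ w) * \1_(cyl J B) w)%:E
   = (bit_mean r k G)%:E * P (cyl J B))%E.
Proof.
elim: k G J B => [|k IH] G J B dG uJ hJ.
  have -> : (fun w => (G (gamma ^~ w) * \1_(cyl J B) w)%:E)
     = (fun w => (G (fun=> false))%:E * (\1_(cyl J B) w)%:E)%E.
    by apply/funext => w; rewrite (dG _ (fun=> false)).
  have i1 : P.-integrable setT (fun w => ((\1_(cyl J B) w : R)%:E)).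
    by apply: integrable_indic => //; exact: measurable_cyl.
  split; first exact: integrableZl.
  rewrite integralZl // integral_indic // ?setIT //; exact: measurable_cyl.
have kJ : k \notin J by apply/negP => /hJ; rewrite ltnn.
(* The value [b] of outcome [k] moves from [G] into the cylinder, leaving a function of the first
   [k] outcomes. *)
have step b := IH (fun s => G (upd s k b)) (k :: J) (upd B k [set b]).
have {}step b :
  P.-integrable setT (fun w => (G (upd (gamma ^~ w) k b)
    * \1_(cyl (k :: J) (upd B k [set b])) w)%:E) /\
  (\int[P]_w (G (upd (gamma ^~ w) k b)
    * \1_(cyl (k :: J) (upd B k [set b])) w)%:E
   = (bit_mean r k (fun s => G (upd s k b)))%:E *
     ((if b then r else 1 - r)%:E * P (cyl J B)))%E.
  rewrite -(prob_cyl_cons k) //; apply: step; first exact: depends_upd.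
    by rewrite /= kJ.
  by move=> j; rewrite inE => /predU1P[->//|/hJ/ltnW].
have -> : (fun w => (G (gamma ^~ w) * \1_(cyl J B) w)%:E) = 
  (fun w => (G (upd (gamma ^~ w) k true)
    * \1_(cyl (k :: J) (upd B k [set true])) w)%:E +
   (G (upd (gamma ^~ w) k false)
    * \1_(cyl (k :: J) (upd B k [set false])) w)%:E)%E.
  apply/funext => w; rewrite !cyl_cons // -EFinD; congr EFin.
  have Gb : G (gamma ^~ w) = G (upd (gamma ^~ w) k (gamma k w)).
    by congr G; apply/funext => i; rewrite /upd; case: eqP => // ->.
  by rewrite Gb; case: (gamma k w); rewrite /= ?mul1r ?mul0r ?mulr0 ?addr0 ?add0r.
have [it et] := step true; have [jf ef] := step false.
split; first exact: integrableD.
rewrite integralD // et ef /=.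
have [p ->] : exists p, P (cyl J B) = p%:E.
  by exists (fine (P (cyl J B))); rewrite fineK // fin_num_measure //;
  exact: measurable_cyl.
rewrite -!EFinM -EFinD; congr EFin.
rewrite bit_mean_lin; ring.
Qed.

Lemma bit_meanE k G : depends_below k G ->
  'E_P[fun w => G (gamma ^~ w)]%E = (bit_mean r k G)%:E.
Proof.
move=> dG; have [//|//|_] := @mean_cyl k G [::] (fun=> setT) dG.
have -> : cyl [::] (fun=> setT) = setT by rewrite /cyl set_nil bigcap_set0.
rewrite probability_setT mule1 unlock => <-.
by apply: eq_integral => w _; rewrite indicT mulr1.
Qed.

End Expectation.

(** * Geometrically discounted sums *)

Section Discounted.
Context {R : realType}.
Variable q : R.
Hypothesis hq : 0 <= q < 1.

Let q0 : 0 <= q. Proof. by case/andP: hq. Qed.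

Definition dpsum (c : nat -> R) (t n : nat) : R := \sum_(j < n) q ^+ j * c (t + j)%N.
Definition dsum (c : nat -> R) (t : nat) : R := limn (dpsum c t).

(** The cost may outgrow the discount, so summability has to be tracked; [dsum] is meaningful only
    under it. *)
Definition dbounded (c : nat -> R) (t : nat) : Prop :=
  exists M, forall n, dpsum c t n <= M.

Lemma dpsumS c t n : dpsum c t n.+1 = c t + q * dpsum c t.+1 n.
Proof.
rewrite /dpsum big_ord_recl /= expr0 mul1r addn0 mulr_sumr; congr (_ + _).
by apply: eq_bigr => i _; rewrite /bump /= add1n exprS mulrA addSnnS.
Qed.

Lemma ler_dpsum c c' t n : (forall i, c i <= c' i) -> dpsum c t n <= dpsum c' t n.
Proof. by move=> cc; apply: ler_sum => j _; rewrite ler_wpM2l // exprn_ge0. Qed.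

Variable c : nat -> R.
Hypothesis c0 : forall t, 0 <= c t.

Lemma dpsum_ge0 t n : 0 <= dpsum c t n.
Proof. by apply: sumr_ge0 => j _; rewrite mulr_ge0 // exprn_ge0. Qed.

Lemma dpsum_nondecreasing t : nondecreasing_seq (dpsum c t).
Proof.
apply/nondecreasing_seqP => n; rewrite {2}/dpsum big_ord_recr /= lerDl.
by rewrite mulr_ge0 // exprn_ge0.
Qed.

Lemma dpsum_cvg t : dbounded c t -> dpsum c t @ \oo --> dsum c t.
Proof.
move=> [M hM]; apply: nondecreasing_is_cvgn; first exact: dpsum_nondecreasing.
by exists M => _ [n _ <-].
Qed.

Lemma dpsum_le_dsum t n : dbounded c t -> dpsum c t n <= dsum c t.
Proof.
move=> b; apply: nondecreasing_cvgn_le; first exact: dpsum_nondecreasing.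
by apply/cvg_ex; exists (dsum c t); exact: dpsum_cvg.
Qed.

Lemma dsum_le t M : (forall n, dpsum c t n <= M) -> dsum c t <= M.
Proof.
move=> hM; apply: limr_le; last by apply: nearW => n; exact: hM.
by apply/cvg_ex; exists (dsum c t); apply: dpsum_cvg; exists M.
Qed.

Lemma dsum_gt t x : dbounded c t -> x < dsum c t -> exists n, x < dpsum c t n.
Proof.
move=> b xs; apply: contrapT => h.
suff : dsum c t <= x by rewrite leNgt xs.
by apply: dsum_le => n; rewrite leNgt; apply/negP => xn; apply: h; exists n.
Qed.

Lemma dsum_rec t : dbounded c t.+1 ->
  dsum c t = c t + q * dsum c t.+1.
Proof.
move=> /dpsum_cvg b1; apply: cvg_lim => //; rewrite -cvg_shiftS.
under eq_cvg do rewrite /= dpsumS.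
apply: cvgD; first exact: cvg_cst.
by apply: cvgM => //; exact: cvg_cst.
Qed.

Hypothesis cS : forall t, c t <= c t.+1.

Lemma cost_homo : {homo c : m n / (m <= n)%N >-> m <= n}.
Proof. exact/nondecreasing_seqP. Qed.

Lemma dpsum_homo n : {homo (dpsum c)^~ n : s t / (s <= t)%N >-> s <= t}.
Proof.
move=> s t st; apply: ler_sum => j _; rewrite ler_wpM2l ?exprn_ge0 //.
by apply: cost_homo; rewrite leq_add2r.
Qed.

Lemma dsum_homo s t : dbounded c t -> (s <= t)%N -> dsum c s <= dsum c t.
Proof.
move=> b st; apply: dsum_le => n.
exact: le_trans (dpsum_homo n _ _ st) (dpsum_le_dsum _ n b).
Qed.

(** The recursion [dpsumS] carries bounds to later starting points, monotonicity of [c] to earlier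
    ones. *)
Lemma dbounded_shift s t : dbounded c s -> dbounded c t.
Proof.
move=> b; suff h k : dbounded c (s + k).
  have [M hM] := h t; exists M => n; apply: le_trans (hM n).
  exact: (dpsum_homo n _ _ (leq_addl s t)).
elim: k => [|k [M hM]]; first by rewrite addn0.
(* For [q = 0] one cannot divide by [q], but the sums reduce to their first term. *)
move: q0; rewrite le_eqVlt => /predU1P[qe|qp].
  exists (c (s + k.+1)%N) => -[|n]; first by rewrite /dpsum big_ord0.
  by rewrite dpsumS -qe mul0r addr0.
exists (M / q) => n; rewrite ler_pdivlMr // mulrC addnS.
by have := hM n.+1; rewrite dpsumS; apply: le_trans; rewrite lerDr.
Qed.

(** [M / (1 - q)] is the fixed point of [x = M + q * x], so the recursion [dpsumS] preserves the
    bound. *)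
Lemma dpsum_ubound M t n : (forall i, c i <= M) -> dpsum c t n <= M / (1 - q).
Proof.
move=> hM; have q1 : 0 < 1 - q by rewrite subr_gt0; case/andP: hq.
have M0 : 0 <= M := le_trans (c0 0%N) (hM 0%N).
elim: n t => [|n IH] t; first by rewrite /dpsum big_ord0 divr_ge0 // ltW.
have := IH t.+1; have := hM t; rewrite dpsumS.
move: (dpsum _ _ _) (c t) => x y hy hx.
have hx' := ler_wpM2l q0 hx.
have : M / (1 - q) = M + q * (M / (1 - q)) by field; rewrite gt_eqF.
lra.
Qed.

End Discounted.

(** * Average costs and relative value functions *)

Lemma limn_esup_lt {R : realType} (u : (\bar R)^nat) (a : \bar R) :
  (limn_esup u < a)%E -> \forall n \near \oo, (u n < a)%E.
Proof.
rewrite /limn_esup limf_esupE => /ereal_inf_lt[_ [V oV <-]] Va.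
apply: filterS oV => n Vn; apply: le_lt_trans Va.
by apply: ereal_sup_ubound; exists n.
Qed.

Lemma limn_esup_le {R : realType} (u : (\bar R)^nat) (b : R) :
  (forall e, 0 < e -> \forall n \near \oo, (u n <= (b + e)%:E)%E) ->
  (limn_esup u <= b%:E)%E.
Proof.
move=> h; apply/lee_addgt0Pr => e e0; rewrite /limn_esup limf_esupE.
apply: ge_ereal_inf; exists (ereal_sup (u @` [set n | (u n <= (b + e)%:E)%E])).
  by exists [set n | (u n <= (b + e)%:E)%E] => //; exact: h.
by apply: ge_ereal_sup => _ [n /= hn <-].
Qed.

Lemma le_limn_esup {R : realType} (u v : (\bar R)^nat) :
  (forall n, (u n <= v n)%E) -> (limn_esup u <= limn_esup v)%E.
Proof.
move=> uv; rewrite !limn_esup_lim.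
apply: lee_lim; [exact: is_cvg_esups|exact: is_cvg_esups|].
apply: nearW => n; apply: ge_ereal_sup => _ [k /= nk <-].
by apply: le_ereal_sup_tmp; exists (v k) => //; exists k.
Qed.

Lemma tau_at_S f s k : tau_at f s k.+1 =
  if action_at f s k && s k then 0%N else (tau_at f s k).+1.
Proof. by rewrite /tau_at /= last_rcons. Qed.

Lemma depends_history f k : depends_below k (fun s => history f s k).
Proof.
elim: k => [//|k IH] s s' ss' /=.
by rewrite (IH s s') ?ss' // => i ik; apply: ss'; rewrite ltnW.
Qed.

Lemma depends_tau f k : depends_below k (fun s => tau_at f s k).
Proof. by move=> s s' ss'; rewrite /tau_at (depends_history f k _ _ ss'). Qed.

Lemma depends_action f k : depends_below k (fun s => action_at f s k).
Proof. by move=> s s' ss'; rewrite /action_at (depends_history f k _ _ ss'). Qed.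

Definition path_cost {R : realType} (l : nat -> bool -> R) (f : policy) (T : nat)
    (s : nat -> bool) : R :=
  \sum_(k < T) l (tau_at f s k) (action_at f s k).

Lemma depends_path_cost {R : realType} (l : nat -> bool -> R) f k T :
  (T <= k.+1)%N -> depends_below k (path_cost l f T).
Proof.
move=> Tk s s' ss'; apply: eq_bigr => i _.
have ik : (i <= k)%N by rewrite -ltnS; apply: leq_trans Tk.
have si j : (j < i)%N -> s j = s' j by move=> ji; apply: ss'; apply: leq_trans ik.
by rewrite (depends_tau f i _ _ si) (depends_action f i _ _ si).
Qed.

(** * Telescoping the dynamic programming inequality *)

Section Drift.
Context {R : realType}.
Variable r : R.
Hypothesis hr : 0 <= r <= 1.

(** The average-cost optimality inequality at one state-action pair, with gain [g] and relative
    value [h]. *)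
Definition drift_ok (l : nat -> bool -> R) (h : nat -> R) (g : R) (t : nat)
    (a : bool) : Prop :=
  g + h t <= l t a + (if a then r * h 0%N + (1 - r) * h t.+1 else h t.+1).

(** Accumulated cost plus [h] of the current state grows in mean by at least [g] per step. The
    inequality is asked only at pairs visited by [f], so it can also certify a single policy. *)
Lemma drift_le f l h g :
  (forall s k, drift_ok l h g (tau_at f s k) (action_at f s k)) ->
  forall T, T%:R * g + h 0%N
    <= bit_mean r T (fun s => path_cost l f T s + h (tau_at f s T)).
Proof.
move=> hd; elim=> [|T IH].
  by rewrite /= /path_cost big_ord0 mul0r add0r.
have -> : T.+1%:R * g + h 0%N = g + (T%:R * g + h 0%N) by rewrite -natr1; ring.
have := lerD2l g (T%:R * g + h 0%N)
  (bit_mean r T (fun s => path_cost l f T s + h (tau_at f s T))).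
rewrite IH => {}IH; apply: le_trans (idP IH) _.
have -> (F : _ -> R) : g + bit_mean r T F = bit_mean r T (fun s => 1 * F s + g * 1).
  by rewrite (bit_mean_lin r T 1 g F (fun=> 1)) bit_mean_cst; ring.
rewrite /=; apply: ler_bit_mean => // s.
(* Outcome [T] first acts on the state at time [T + 1]; the costs through time [T] do not see it. *)
have up b : path_cost l f T.+1 (upd s T b)
    = path_cost l f T s + l (tau_at f s T) (action_at f s T).
  transitivity (path_cost l f T.+1 s); last by rewrite /path_cost big_ord_recr.
  apply: (depends_path_cost l f T T.+1) => // i iT.
  by rewrite /upd ltn_eqF.
have sT b i : (i < T)%N -> upd s T b i = s i by move=> iT; rewrite /upd ltn_eqF.
rewrite !up !tau_at_S (depends_action f T _ _ (sT true)).
rewrite (depends_action f T _ _ (sT false)).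
rewrite (depends_tau f T _ _ (sT true)) (depends_tau f T _ _ (sT false)).
rewrite {1 2}/upd eqxx; have := hd s T; rewrite /drift_ok.
case: action_at => /=; lra.
Qed.

End Drift.

(** * From drift inequalities to bounds on long-run averages *)

Section Objective.
Context {R : realType} {d : measure_display} {Omega : measurableType d}.
Variable P : probability Omega R.
Variables (r : R) (gamma : nat -> {RV P >-> bool}).
Hypothesis hr : 0 <= r <= 1.
Hypothesis hgamma : channel r gamma.

Definition mean_rate (l : nat -> bool -> R) f (T : nat) : R :=
  T%:R^-1 * bit_mean r T (path_cost l f T).

Lemma expected_path_cost l f T :
  ((T%:R^-1)%:E * 'E_P[fun w => path_cost l f T (gamma ^~ w)])%E
  = (mean_rate l f T)%:E.
Proof.
rewrite (bit_meanE P r gamma hgamma T); first by rewrite EFinM.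
by apply: depends_path_cost.
Qed.

Lemma J_eE cost f :
  J_e gamma cost f = limn_esup (fun T => (mean_rate (fun t _ => cost t) f T)%:E).
Proof.
by congr limn_esup; apply/funext => T; rewrite -expected_path_cost.
Qed.

Lemma J_rE f :
  J_r gamma f = limn_esup (fun T => (mean_rate (fun _ a => a%:R) f T)%:E).
Proof.
by congr limn_esup; apply/funext => T; rewrite -expected_path_cost.
Qed.

Lemma ler_mean_rate l f l' f' T :
  (forall s k, l (tau_at f s k) (action_at f s k)
     <= l' (tau_at f' s k) (action_at f' s k)) ->
  mean_rate l f T <= mean_rate l' f' T.
Proof.
move=> ll; rewrite ler_wpM2l ?invr_ge0 ?ler0n //.
by apply: ler_bit_mean => // s; apply: ler_sum => k _; exact: ll.
Qed.

Lemma mean_rate_ge0 l f T : (forall t a, 0 <= l t a) -> 0 <= mean_rate l f T.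
Proof.
move=> l0; rewrite mulr_ge0 ?invr_ge0 // -[leLHS](bit_mean_cst r T).
by apply: ler_bit_mean => // s; apply: sumr_ge0.
Qed.

Lemma J_r_ge0 f : (0 <= J_r gamma f)%E.
Proof.
rewrite J_rE; apply: limf_esup_ge0 => [|T]; first exact: filter_not_empty.
by rewrite lee_fin mean_rate_ge0.
Qed.

Lemma J_e_ge0 cost f : (forall t, 0 <= cost t) -> (0 <= J_e gamma cost f)%E.
Proof.
move=> c0; rewrite J_eE; apply: limf_esup_ge0 => [|T]; first exact: filter_not_empty.
by rewrite lee_fin mean_rate_ge0.
Qed.

Lemma le_J_e cost f f' :
  (forall s k, cost (tau_at f s k) <= cost (tau_at f' s k)) ->
  (J_e gamma cost f <= J_e gamma cost f')%E.
Proof.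
by move=> h; rewrite !J_eE; apply: le_limn_esup => T; rewrite lee_fin ler_mean_rate.
Qed.

Lemma le_J_r f f' :
  (forall s k, (action_at f s k <= action_at f' s k)%N) ->
  (J_r gamma f <= J_r gamma f')%E.
Proof.
move=> h; rewrite !J_rE; apply: le_limn_esup => T; rewrite lee_fin ler_mean_rate //.
by move=> s k; rewrite ler_nat.
Qed.

Lemma near_nat_large (e K : R) : 0 < e ->
  \forall T \near \oo, (0 < T)%N /\ K <= T%:R * e.
Proof.
move=> e0; near=> T; split; first by near: T; exists 1%N.
rewrite -ler_pdivrMr //; near: T; exact: nbhs_infty_ger.
Unshelve. all: by end_near. Qed.

(** Negating cost, value and gain turns [drift_le] into an upper bound. The lower bound on [h] keeps
    the terminal term bounded, so it vanishes after division by [T]. *)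
Lemma J_e_upper cost f h g K :
  (forall s k, drift_ok r (fun t _ => - cost t) (fun t => - h t) (- g)
     (tau_at f s k) (action_at f s k)) ->
  (forall t, - K <= h t) -> (J_e gamma cost f <= g%:E)%E.
Proof.
move=> hd hK; rewrite J_eE; apply: limn_esup_le => e e0.
apply: filterS (near_nat_large e (K + h 0%N) e0) => T [T0 hT].
rewrite lee_fin /mean_rate mulrC ler_pdivrMr ?ltr0n //.
have hl : bit_mean r T (fun s => path_cost (fun t _ => - cost t) f T s - h (tau_at f s T))
    <= bit_mean r T (fun s => (-1) * path_cost (fun t _ => cost t) f T s + K * 1).
  apply: ler_bit_mean => // s; have := hK (tau_at f s T).
  rewrite /path_cost sumrN; lra.
have := le_trans (drift_le r hr f _ _ _ hd T) hl.
rewrite (bit_mean_lin r T (-1) K _ (fun=> 1)) bit_mean_cst; lra.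
Qed.

(** If the objective were below [g], both averages would at one common large [T] be so close to or
    below their upper limits that [drift_le] fails there. *)
Lemma objective_lower cost lambda f h g M :
  (forall t, 0 <= cost t) -> 0 <= lambda ->
  (forall s k, drift_ok r (fun t a => cost t + lambda * a%:R) h g
     (tau_at f s k) (action_at f s k)) ->
  (forall t, h t <= M) -> (g%:E <= costly_objective gamma cost lambda f)%E.
Proof.
move=> c0 l0 hd hM; rewrite leNgt; apply/negP; rewrite /costly_objective => lt_g.
have e0 := J_e_ge0 cost f c0; have r0 := J_r_ge0 f.
have lr0 : (0 <= lambda%:E * J_r gamma f)%E by rewrite mule_ge0 // lee_fin.
have [x xE] : exists x, J_e gamma cost f = x%:E.
  move: e0 lt_g; case: (J_e _ _ _) => [x _ _| |//]; first by exists x.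
  by rewrite addye // gt_eqF // (lt_le_trans _ lr0) // ltNyr.
have [y yE] : exists y, J_r gamma f = y%:E.
  have : (J_r gamma f <= 1%:E)%E.
    rewrite J_rE; apply: limn_esup_le => e ee; apply: nearW => T; rewrite lee_fin.
    have := ler_mean_rate (fun _ a => a%:R) f (fun _ _ => 1) f T.
    have -> : mean_rate (fun _ _ => 1) f T = T%:R^-1 * T%:R.
      rewrite /mean_rate; congr (_ * _).
      rewrite -[RHS](bit_mean_cst r T); congr bit_mean; apply/funext => s.
      by rewrite /path_cost sumr_const card_ord.
    have [->|T0] := eqVneq T 0%N.
      by rewrite mulr0 => /(_ _)/le_trans; apply=> [s k|]; [case: action_at|lra].
    rewrite mulVf ?pnatr_eq0 // => /(_ _)/le_trans; apply=> [s k|]; last lra.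
    by case: action_at => //=; rewrite ler01.
  by move: r0; case: (J_r _ _) => [y _ _| |//]; first by exists y.
move: lt_g e0 r0; rewrite xE yE -EFinM -EFinD lte_fin !lee_fin => lt_g x0 y0.
(* Half of the gap, [e * (1 + lambda)], pays for the slack in the two averages; the other half
   absorbs [(M - h 0) / T]. *)
pose e := (g - (x + lambda * y)) / (2 * (1 + lambda)).
have l1 : 0 < 1 + lambda by lra.
have e0 : 0 < e by rewrite divr_gt0 // ?mulr_gt0 //; lra.
have eE : e * (2 * (1 + lambda)) = g - (x + lambda * y).
  by rewrite /e mulfVK // gt_eqF // mulr_gt0.
have : (J_e gamma cost f < (x + e)%:E)%E by rewrite xE lte_fin; lra.
have : (J_r gamma f < (y + e)%:E)%E by rewrite yE lte_fin; lra.
rewrite J_eE J_rE => /limn_esup_lt hr' /limn_esup_lt he.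
have e1 : 0 < e * (1 + lambda) by rewrite mulr_gt0.
have /filter_ex[T [[T0 hT] uT vT]] : \forall T \near \oo,
  [/\ (0 < T)%N /\ M - h 0%N <= T%:R * (e * (1 + lambda)),
   ((mean_rate (fun t _ => cost t) f T)%:E < (x + e)%:E)%E &
   ((mean_rate (fun _ a => a%:R) f T)%:E < (y + e)%:E)%E].
  by apply: filterS3 (near_nat_large _ (M - h 0%N) e1) he hr' => T.
move: uT vT; rewrite !lte_fin /mean_rate => uT vT.
have hl : bit_mean r T
    (fun s => path_cost (fun t a => cost t + lambda * a%:R) f T s + h (tau_at f s T))
    <= bit_mean r T (fun s => 1 * path_cost (fun t _ => cost t) f T s +
      1 * (lambda * path_cost (fun _ a => a%:R) f T s + M * 1)).
  apply: ler_bit_mean => // s; have := hM (tau_at f s T).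
  rewrite /path_cost big_split /= -mulr_sumr; lra.
have := le_trans (drift_le r hr f _ _ _ hd T) hl.
rewrite !bit_mean_lin bit_mean_cst.
have Tp : 0 < T%:R :> R by rewrite ltr0n.
move: uT vT; rewrite ![T%:R^-1 * _]mulrC !ltr_pdivrMr //.
move: (bit_mean _ _ _) (bit_mean _ _ _) => u v hu hv.
have := ler_wpM2l l0 (ltW hv).
have : T%:R * (e * (2 * (1 + lambda)))
    = T%:R * (g - (x + lambda * y)) by rewrite eE.
nra.
Qed.

End Objective.

(** * The best threshold policy *)

Section Threshold.
Context {R : realType} {d : measure_display} {Omega : measurableType d}.
Variable P : probability Omega R.
Variables (r : R) (gamma : nat -> {RV P >-> bool}).
Hypothesis hr : 0 <= r <= 1.
Hypothesis hgamma : channel r gamma.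

(* Relative value of the states reached from 0 without transmitting. *)
Definition surplus (c : nat -> R) (g : R) (t : nat) : R := \sum_(i < t) (g - c i).

Lemma surplusS c g t : surplus c g t.+1 = surplus c g t + (g - c t).
Proof. by rewrite /surplus big_ord_recr. Qed.

Lemma surplus0 c g : surplus c g 0 = 0.
Proof. by rewrite /surplus big_ord0. Qed.

(* Capping the cost keeps the relative value function bounded, so that it drops
   out of the long-run average under every policy. *)
Definition capped (c : nat -> R) (N t : nat) : R := c (minn t N).

Let q := 1 - r.

Let hq : 0 < r -> 0 <= q < 1.
Proof. by move=> r0; rewrite /q subr_ge0 gtrDl oppr_lt0 r0; case/andP: hr => _ ->. Qed.

(** * Cost of a given threshold policy *)

Section UpperBound.
Variable c : nat -> R.
Hypothesis c0 : forall t, 0 <= c t.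
Hypothesis cS : forall t, c t <= c t.+1.

(** Mean cost of a cycle between successes over its mean length, [theta] silent steps and [1 / r]
    attempts. An explicit relative value certifies the ratio. *)
Lemma threshold_J_e theta : 0 < r -> dbounded q c 0 ->
  (J_e gamma c (threshold theta)
   <= ((\sum_(i < theta) c i + dsum q c theta) / (theta%:R + r^-1))%:E)%E.
Proof.
move=> r0 b0; have hqr := hq r0.
have bd t : dbounded q c t := dbounded_shift q hqr c c0 cS 0%N t b0.
have rn : r != 0 by rewrite gt_eqF.
have L0 : 0 < theta%:R + r^-1 :> R by rewrite ltr_wpDl ?ler0n // invr_gt0.
set g := (_ / _).
have gE : g * (theta%:R + r^-1) = \sum_(i < theta) c i + dsum q c theta.
  by rewrite /g mulfVK // gt_eqF.
have s0 t : 0 <= dsum q c t.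
  by apply: le_trans (dpsum_le_dsum q hqr c c0 t 0 (bd t)); rewrite dpsum_ge0.
have g0 : 0 <= g.
  by apply: divr_ge0 (ltW L0); apply: addr_ge0 => //; exact: sumr_ge0.
have gr : 0 <= g / r by rewrite divr_ge0 // ltW.
(* The choice of [g] is exactly what makes the two branches of [h] below agree at [theta]. *)
have Dth : surplus c g theta = dsum q c theta - g / r.
  have : surplus c g theta = g * theta%:R - \sum_(i < theta) c i.
    by rewrite /surplus sumrB sumr_const card_ord mulr_natr.
  move: gE; rewrite mulrDr; lra.
(* From [theta] on: the mean cost until the next success, minus [g] times the mean waiting time
   [1 / r]. *)
pose h t := if (t < theta)%N then surplus c g t else dsum q c t - g / r.
have h0 : h 0%N = 0.
  rewrite /h; case: ifP => [_|]; first exact: surplus0.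
  by move/negbT; rewrite -leqNgt leqn0 => /eqP th0; move: Dth; rewrite th0 surplus0.
have hle t : (t <= theta)%N -> h t = surplus c g t.
  by rewrite /h leq_eqVlt => /predU1P[->|->//]; rewrite ltnn Dth.
apply: (J_e_upper P r gamma hr hgamma c (threshold theta) h g
  (\sum_(i < theta) c i + g / r)).
  move=> s k; rewrite /drift_ok h0.
  have -> : action_at (threshold theta) s k
    = (theta <= tau_at (threshold theta) s k)%N by [].
  move: (tau_at _ _ _) => t; case: leqP => tt; last first.
    by rewrite !hle ?(ltnW tt) // surplusS; lra.
  rewrite /h !ltnNge tt leqW //= (dsum_rec q hqr c c0 t (bd t.+1)).
  have : g / r = g + q * (g / r) by rewrite /q; field.
  rewrite /q; move: (g / r) (dsum _ _ _) => y z; lra.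
move=> t; rewrite /h; case: ifP => tt.
  have : \sum_(i < t) c i <= \sum_(i < theta) c i.
    rewrite -(subnKC (ltnW tt)) big_split_ord /= lerDl; exact: sumr_ge0.
  have : surplus c g t = g * t%:R - \sum_(i < t) c i.
    by rewrite /surplus sumrB sumr_const card_ord mulr_natr.
  have : 0 <= g * t%:R by rewrite mulr_ge0.
  lra.
have := s0 t; have : 0 <= \sum_(i < theta) c i by exact: sumr_ge0.
lra.
Qed.

End UpperBound.

Variable c : nat -> R.
Hypothesis c0 : forall t, 0 <= c t.
Hypothesis cS : forall t, c t <= c t.+1.

(** Under a threshold policy the action is a nondecreasing function of the state, so [threshold_J_e]
    applies with it as cost. *)
Lemma threshold_J_r theta : 0 < r ->
  (J_r gamma (threshold theta) <= (r^-1 / (theta%:R + r^-1))%:E)%E.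
Proof.
move=> r0; have hqr := hq r0.
pose a t : R := (theta <= t)%N%:R.
have a0 t : 0 <= a t by exact: ler0n.
have aS t : a t <= a t.+1.
  by rewrite ler_nat /a; case: (leqP theta t) => // tt; rewrite leqW.
have a1 t : a t <= 1 by rewrite /a; case: leqP.
have ub t n : dpsum q a t n <= r^-1.
  have := dpsum_ubound q hqr a a0 1 t n a1; by rewrite /q subKr mul1r.
have := threshold_J_e a a0 aS theta r0 (ex_intro _ _ (ub 0%N)).
move=> /le_trans; apply; rewrite lee_fin ler_wpM2r ?invr_ge0 //.
  by rewrite addr_ge0 // invr_ge0 ltW.
rewrite [X in X + _]big1 ?add0r; last by move=> i _; rewrite /a leqNgt ltn_ord.
exact: (dsum_le q hqr a a0).
Qed.

(** * Lower bound for all policies *)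

Let cap0 N t : 0 <= capped c N t. Proof. exact: c0. Qed.

Let capS N t : capped c N t <= capped c N t.+1.
Proof. by apply: (cost_homo c cS); rewrite /capped; lia. Qed.

Let cap_le N t : capped c N t <= c t.
Proof. exact: (cost_homo c cS _ _ (geq_minl _ _)). Qed.

Let cap_bd N t : 0 < r -> dbounded q (capped c N) t.
Proof.
move=> r0; exists (c N / (1 - q)) => n; apply: (dpsum_ubound q (hq r0)) => //.
by move=> i; exact: (cost_homo c cS _ _ (geq_minr _ _)).
Qed.

Let cap_homo N N' t : 0 < r -> (N <= N')%N ->
  dsum q (capped c N) t <= dsum q (capped c N') t.
Proof.
move=> r0 NN; apply: (dsum_le q (hq r0)) => // n.
apply: le_trans (dpsum_le_dsum q (hq r0) _ (cap0 N') t n (cap_bd N' t r0)).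
apply: (ler_dpsum q (hq r0)) => i.
by apply: (cost_homo c cS); lia.
Qed.

(** From [t1] on the increments [g - c t] are nonpositive; earlier ones are at most [|g|]. *)
Lemma surplus_ubound g t1 : g <= c t1 -> exists M, forall t, surplus c g t <= M.
Proof.
move=> gt1; exists (`|g| * t1%:R); elim=> [|t IH].
  by rewrite surplus0 mulr_ge0.
have [tt|tt] := ltnP t t1; last first.
  by rewrite surplusS; have := cost_homo c cS _ _ tt; lra.
apply: le_trans (_ : `|g| * t.+1%:R <= _); last by rewrite ler_wpM2l // ler_nat.
elim: (t.+1) => [|k IHk]; first by rewrite surplus0 mulr0.
rewrite surplusS -natr1; have := c0 k; have := ler_norm g; lra.
Qed.

(** The hypothesis on [theta] encodes that [g] is below the cost of each threshold policy; the cap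
    gives it a meaning even when the discounted sum diverges. *)
Lemma objective_ge lambda g t1 f : 0 <= lambda -> g < c t1 ->
  (0 < r -> forall theta, exists N,
     surplus c g theta <= dsum q (capped c N) theta + (lambda - g) / r) ->
  (g%:E <= costly_objective gamma c lambda f)%E.
Proof.
move=> l0 gt1 hN.
have [MD hMD] := surplus_ubound g t1 (ltW gt1).
(* Relative to waiting, transmitting at [t] gains [r * surplus c g t.+1] and costs [lambda]. If it
   never pays, [surplus] alone serves as [h]. *)
have [hall|] := pselect (forall t, r * surplus c g t.+1 <= lambda).
  apply: (objective_lower P r gamma hr hgamma c lambda f (surplus c g) g MD) => //.
  move=> s k; move: (tau_at _ _ _) (action_at _ _ _) => t [];
    rewrite /drift_ok /= ?surplus0 surplusS; last lra.
  have := hall t; rewrite surplusS; lra.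
move=> /existsNP[i0 /negP]; rewrite -ltNge => hi0.
(* Otherwise [i] is the first state where transmitting beats waiting; [h] switches from [surplus] to
   [V] after it. *)
have exi : exists i, lambda < r * surplus c g i.+1 by exists i0.
have [i hi imin] := ex_minnP exi; clear exi i0 hi0.
have r0 : 0 < r.
  case/andP: hr; rewrite le_eqVlt => /predU1P[rE|//].
  by move: hi; rewrite -rE mul0r ltNge l0.
have rn : r != 0 by rewrite gt_eqF.
have hqr := hq r0.
(* Raising the cap only increases the discounted sums, so one cap serves both thresholds [i] and
   [i.+1]. *)
have [N [hNi hNi1]] : exists N,
    surplus c g i <= dsum q (capped c N) i + (lambda - g) / r /\
    surplus c g i.+1 <= dsum q (capped c N) i.+1 + (lambda - g) / r.
  have [N1 h1] := hN r0 i; have [N2 h2] := hN r0 i.+1.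
  exists (maxn N1 N2); split.
    by apply: le_trans h1 _; rewrite lerD2r cap_homo // leq_maxl.
  by apply: le_trans h2 _; rewrite lerD2r cap_homo // leq_maxr.
(* Relative value of transmitting from state t until the first success. *)
pose V t := dsum q (capped c N) t + (lambda - g) / r.
have VE t : V t = capped c N t + (lambda - g) + q * V t.+1.
  rewrite /V (dsum_rec q hqr _ (cap0 N) t (cap_bd N t.+1 r0)).
  by rewrite /q; field.
have V_homo s t : (s <= t)%N -> V s <= V t.
  by move=> st; rewrite lerD2r; apply: (dsum_homo q hqr) => //; exact: cap_bd.
(* Hence beyond [i] waiting is no better than transmitting. *)
have Vl t : (i < t)%N -> lambda <= r * V t.
  move=> it; apply: le_trans (ltW hi) _; rewrite ler_pM2l //.
  by apply: le_trans hNi1 _; exact: V_homo.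
pose h t := if (t <= i)%N then surplus c g t else V t.
apply: (objective_lower P r gamma hr hgamma c lambda f h g
  (Num.max MD (c N / (1 - q) + (lambda - g) / r))) => //; last first.
  move=> t; rewrite /h le_max; case: leqP => _; first by rewrite hMD.
  apply/orP; right; rewrite lerD2r; apply: (dsum_le q hqr) => // n.
  by apply: (dpsum_ubound q hqr) => // j; exact: (cost_homo c cS _ _ (geq_minr _ _)).
move=> s k; move: (tau_at _ _ _) (action_at _ _ _) => t a.
have h0 : h 0%N = 0 by rewrite /h surplus0.
rewrite /drift_ok h0 /h.
have hct := cap_le N t; have hVt := VE t.
case: (ltngtP t i) => [ti|it|ti].
(* Before [i], waiting gives equality and minimality of [i] handles transmitting. *)
- case: a; rewrite ?mulr1 ?mulr0 surplusS; last lra.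
  have : r * surplus c g t.+1 <= lambda.
    by rewrite leNgt; apply/negP => /imin; rewrite leqNgt ti.
  rewrite surplusS; lra.
- have := Vl t.+1 (ltnW it); rewrite /q in hVt.
  case: a; rewrite ?mulr1 ?mulr0; move: (V t) (V t.+1) hVt => y z; lra.
(* At the junction, the hypothesis for threshold [i] settles transmitting and that for [i.+1]
   settles waiting. *)
- subst t; move: hNi1 hNi; rewrite -/(V _) -/(V _) surplusS /q in hVt *.
  case: a; rewrite ?mulr1 ?mulr0; lra.
Qed.

Lemma exists_optimal_threshold lambda f0 x t1 : 0 <= lambda ->
  (costly_objective gamma c lambda f0 <= x%:E)%E -> x < c t1 ->
  exists theta, forall f, (costly_objective gamma c lambda (threshold theta)
    <= costly_objective gamma c lambda f)%E.
Proof.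
move=> l0 f0x xt1.
(* Above the cost of [f0], so [objective_ge] must fail at [g1]; below [c t1], so late thresholds
   cost more than [g1]. *)
pose g1 := (x + c t1) / 2.
have [xg1 g1t1] : x < g1 /\ g1 < c t1 by rewrite /g1; split; lra.
have not_ge : ~ (0 < r -> forall theta, exists N,
     surplus c g1 theta <= dsum q (capped c N) theta + (lambda - g1) / r).
  move=> /(objective_ge lambda g1 t1 f0 l0 g1t1).
  by move=> /le_trans/(_ f0x); rewrite lee_fin leNgt xg1.
have r0 : 0 < r by apply: contrapT => nr; apply: not_ge.
have hqr := hq r0.
(* The failure yields a threshold whose capped sums are bounded uniformly in [N], whence the
   uncapped sums converge. *)
have [th1 hth1] : exists theta, forall N,
    dsum q (capped c N) theta + (lambda - g1) / r < surplus c g1 theta.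
  apply: contrapT => /forallNP hn; apply: not_ge => _ theta.
  have /existsNP[N /negP] := hn theta; rewrite -leNgt => ?; by exists N.
have dps n t : dpsum q c t n <= dsum q (capped c (t + n)) t.
  apply: le_trans (dpsum_le_dsum q hqr _ (cap0 (t + n)) t n (cap_bd _ t r0)).
  apply: ler_sum => j _; rewrite /capped (minn_idPl _) //.
  by rewrite leq_add2l ltnW.
have b1 : dbounded q c th1.
  exists (surplus c g1 th1 - (lambda - g1) / r) => n.
  by have := dps n th1; have := hth1 (th1 + n)%N; lra.
have bd t : dbounded q c t := dbounded_shift q hqr c c0 cS th1 t b1.
pose W t := \sum_(i < t) c i + dsum q c t + lambda / r.
pose L t : R := t%:R + r^-1.
pose J t := W t / L t.
have L0 t : 0 < L t by rewrite ltr_wpDl ?ler0n // invr_gt0.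
have surplusJ g t : (surplus c g t < dsum q c t + (lambda - g) / r) = (g < J t).
  rewrite /J ltr_pdivlMr // /W /L /surplus sumrB sumr_const card_ord -mulr_natr.
  rewrite mulrDr mulrBl; apply/idP/idP; lra.
have Jth1 : J th1 <= g1.
  rewrite leNgt -surplusJ -leNgt.
  suff : dsum q c th1 <= surplus c g1 th1 - (lambda - g1) / r by lra.
  apply: (dsum_le q hqr) => // n.
  by have := dps n th1; have := hth1 (th1 + n)%N; lra.
have [B hB] : exists B, forall t, (B <= t)%N -> g1 < J t.
  (* From [t1] on [surplus c g1] falls by at least [e] per step, so it ends up below the level that
     [surplusJ] compares it with. *)
  pose e := c t1 - g1; have e0 : 0 < e by rewrite /e subr_gt0.
  have [M hM] := surplus_ubound g1 t1 (ltW g1t1).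
  have [B [_ hB]] : exists B, (0 < B)%N /\ M - (lambda - g1) / r + 1 <= B%:R * e.
    by have /filter_ex := near_nat_large e (M - (lambda - g1) / r + 1) e0.
  exists (t1 + B)%N => t tB; rewrite -surplusJ.
  have : surplus c g1 (t1 + B) <= M - B%:R * e.
    elim: (B) => [|k IH]; first by rewrite addn0 mul0r subr0.
    rewrite addnS surplusS -natr1 mulrDl mul1r.
    have := cost_homo c cS _ _ (leq_addr k t1); rewrite /e in IH *; lra.
  have : surplus c g1 t <= surplus c g1 (t1 + B).
    rewrite -(subnKC tB); elim: (t - _)%N => [|k IH]; first by rewrite addn0.
    rewrite addnS surplusS.
    have : c t1 <= c (t1 + B + k)%N by apply: (cost_homo c cS); lia.
    lra.
  have : 0 <= dsum q c t.
    by apply: le_trans (dpsum_le_dsum q hqr c c0 t 0 (bd t)); rewrite dpsum_ge0.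
  lra.
have th1B : (th1 < B)%N by rewrite ltnNge; apply/negP => /hB; rewrite ltNge Jth1.
have [ths _ hths] := Order.TotalTheory.arg_minP (i0 := Ordinal th1B)
  (P := predT) (fun i : 'I_B => J i) isT.
have hmin t : J ths <= J t.
  have [tB|tB] := ltnP t B; first exact: (hths (Ordinal tB)).
  apply: le_trans (hths (Ordinal th1B) isT) _.
  by apply: le_trans Jth1 _; apply: ltW; exact: hB.
have Jg1 : J ths <= g1 by apply: le_trans (hmin th1) Jth1.
exists ths => f; apply: (@le_trans _ _ (J ths)%:E).
  apply: (@le_trans _ _ (((\sum_(i < ths) c i + dsum q c ths) / L ths)%:E
     + lambda%:E * (r^-1 / L ths)%:E)%E).
    apply: leeD; first exact: threshold_J_e.
    by apply: lee_wpmul2l; [rewrite lee_fin|exact: threshold_J_r].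
  by rewrite -EFinM -EFinD lee_fin /J /W mulrA -mulrDl.
(* The slack [e] makes the comparison with [J theta] strict, so it survives truncating the
   discounted sum and hence capping the cost. *)
apply/lee_subgt0Pr => e e0; rewrite -EFinB.
apply: (objective_ge lambda _ t1) => //; first lra.
move=> _ theta.
have : J ths - e < J theta by have := hmin theta; lra.
rewrite -surplusJ -ltrBlDr => /(dsum_gt q hqr c c0 theta _ (bd theta))[n hn].
by exists (theta + n)%N; have := dps n theta; lra.
Qed.

End Threshold.

(** * Error covariances *)

Section Covariance.
Context {R : realType}.

Lemma psd_congr p k (B : 'M[R]_(p, k)) (S : 'M[R]_k) :
  psd S -> psd (B *m S *m B^T).
Proof.
move=> [sS pS]; split; first by rewrite !trmx_mul trmxK sS mulmxA.
by move=> x; have := pS (x *m B); rewrite trmx_mul !mulmxA.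
Qed.

Lemma psdD k (S T : 'M[R]_k) : psd S -> psd T -> psd (S + T).
Proof.
move=> [sS pS] [sT pT]; split; first by rewrite linearD /= sS sT.
by move=> x; rewrite mulmxDr mulmxDl mxE addr_ge0.
Qed.

Lemma pd_psd k (S : 'M[R]_k) : pd S -> psd S.
Proof.
move=> [sS pS]; split => // x; have [->|x0] := eqVneq x 0; last exact/ltW/pS.
by rewrite !mul0mx mxE.
Qed.

Lemma psd_pdD k (S T : 'M[R]_k) : psd S -> pd T -> pd (S + T).
Proof.
move=> [sS pS] [sT pT]; split; first by rewrite linearD /= sS sT.
by move=> x x0; rewrite mulmxDr mulmxDl mxE ltr_wpDl ?pS ?pT.
Qed.

Lemma pd_unitmx k (S : 'M[R]_k) : pd S -> S \in unitmx.
Proof.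
move=> [_ pS]; rewrite -row_free_unit -kermx_eq0; apply/rowV0P => v.
move=> /sub_kermxP vS; apply/eqP; apply: contraT => /pS.
by rewrite vS mul0mx mxE ltxx.
Qed.

(** [S^-1 = S^-1 S S^-T] is a congruence of [S]. *)
Lemma psd_invmx k (S : 'M[R]_k) : pd S -> psd (invmx S).
Proof.
move=> pS; have uS := pd_unitmx _ _ pS; have [sS _] := pS.
have := psd_congr _ _ (invmx S) S (pd_psd _ _ pS).
by rewrite mulVmx // mul1mx trmx_inv sS.
Qed.

Lemma psd_tr k (S : 'M[R]_k) : psd S -> 0 <= \tr S.
Proof.
move=> [_ pS]; apply: sumr_ge0 => i _; have := pS (delta_mx 0 i).
by rewrite -rowE trmx_delta -colE !mxE.
Qed.

Lemma trmxX n (A : 'M[R]_n) t : A^T ^+ t = (A ^+ t)^T.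
Proof.
elim: t => [|t IH]; first by rewrite !expr0 trmx1.
by rewrite exprS -mulmxE IH -trmx_mul mulmxE -exprSr.
Qed.

(** * The Kalman filter iteration and its limit *)

Section Filter.
Context (n m : nat) (A : 'M[R]_n) (C : 'M[R]_(m, n)) (Sw : 'M[R]_n).
Context (Sv : 'M[R]_m).
Hypotheses (hSw : psd Sw) (hSv : pd Sv).

(** The correction is a congruence of the inverse innovation covariance: a measurement never
    increases the error covariance. *)
Lemma kf_update_gain_psd X : psd X -> psd (X - kf_update C Sv X).
Proof.
move=> pX; have [sX _] := pX.
have := psd_congr _ _ (X *m C^T) _
  (psd_invmx _ _ (psd_pdD _ _ _ (psd_congr _ _ C _ pX) hSv)).
by rewrite /kf_update opprB addrCA subrr addr0 trmx_mul trmxK sX !mulmxA.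
Qed.

(* Joseph form: X - K C X = (1 - K C) X (1 - K C)^T + K Sv K^T. *)
Lemma psd_kf_update X : psd X -> psd (kf_update C Sv X).
Proof.
move=> pX; have [sX _] := pX; have [sSv _] := hSv.
have pS := psd_pdD _ _ _ (psd_congr _ _ C _ pX) hSv.
have uS := pd_unitmx _ _ pS; have [sS _] := pS.
set S := C *m X *m C^T + Sv in pS uS sS.
pose K := X *m C^T *m invmx S.
suff -> : kf_update C Sv X = (1%:M - K *m C) *m X *m (1%:M - K *m C)^T + K *m Sv *m K^T.
  by apply: psdD; apply: psd_congr => //; exact: pd_psd.
have KS : K *m S = X *m C^T by rewrite /K mulmxKV.
have SvE : Sv = S - C *m X *m C^T by rewrite /S addrC addKr.
have -> : K *m Sv *m K^T = X *m C^T *m K^T - K *m C *m X *m C^T *m K^T.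
  by rewrite SvE mulmxBr KS mulmxBl !mulmxA.
have -> : (1%:M - K *m C) *m X *m (1%:M - K *m C)^T
    = X - K *m C *m X - X *m C^T *m K^T + K *m C *m X *m C^T *m K^T.
  rewrite linearB /= trmx1 trmx_mul mulmxBl mul1mx mulmxBr mulmx1 mulmxBl.
  by rewrite opprB !mulmxA addrA addrAC.
by rewrite -[RHS]addrA [X in _ = _ + X]addrCA subrr addr0 subrK /kf_update -/S /K.
Qed.

Lemma psd_kf_cov Pi0 k : psd Pi0 -> psd (kf_cov A C Sw Sv Pi0 k).
Proof.
move=> h; elim: k => [|k IH] /=; apply: psd_kf_update => //.
by apply: psdD => //; apply: psd_congr.
Qed.

Lemma continuous_mxtrace_mul p (B : 'M[R]_(n, p)) :
  continuous (fun X : 'M[R]_(p, n) => \tr (B *m X)).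
Proof.
have -> : (fun X : 'M[R]_(p, n) => \tr (B *m X))
    = fun X => \sum_i \sum_j B i j * X j i.
  by apply/funext => X; apply: eq_bigr => i _; rewrite mxE.
have ac : continuous (fun x : R * R => x.1 + x.2) by exact: add_continuous.
apply: (continuous_big ac) => i _; apply: (continuous_big ac) => j _.
move=> X; apply: (@continuousM _ _ (fun=> B i j) (fun X : 'M[R]_(p, n) => X j i)).
  exact: cst_continuous.
exact: coord_continuous.
Qed.

(** Each filter covariance is an update of the prediction from its predecessor, hence below it. Both
    traces are continuous in the covariance, so the inequality passes to the limit. *)
Lemma steady_state_trace_le Pi0 Pbar (B : 'M[R]_n) : psd Pi0 ->
  steady_state_cov A C Sw Sv Pi0 Pbar ->
  \tr (B *m Pbar *m B^T) <= \tr (B *m kf_predict A Sw Pbar *m B^T).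
Proof.
move=> hPi0 hP.
have tE (F G : 'M[R]_n) : \tr (F *m G *m F^T) = \tr ((F^T *m F) *m G).
  by rewrite mxtrace_mulC mulmxA.
have predE (X : 'M[R]_n) : \tr (B *m kf_predict A Sw X *m B^T)
   = \tr (((B *m A)^T *m (B *m A)) *m X) + \tr (B *m Sw *m B^T).
  by rewrite -tE /kf_predict mulmxDr mulmxDl linearD /= trmx_mul !mulmxA.
rewrite predE tE.
have cP1 : [sequence kf_cov A C Sw Sv Pi0 k.+1]_k @ \oo --> Pbar by rewrite cvg_shiftS.
have l1 := continuous_cvg eventually_filter
  (continuous_mxtrace_mul _ (B^T *m B) Pbar) cP1.
have l2 := continuous_cvg eventually_filter
  (continuous_mxtrace_mul _ ((B *m A)^T *m (B *m A)) Pbar) hP.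
have l3 : \tr ((B *m A)^T *m (B *m A) *m kf_cov A C Sw Sv Pi0 k)
      + \tr (B *m Sw *m B^T) @[k --> \oo]
    --> \tr ((B *m A)^T *m (B *m A) *m Pbar) + \tr (B *m Sw *m B^T).
  by apply: cvgD; [exact: l2|exact: cvg_cst].
rewrite -(cvg_lim _ l1) // -(cvg_lim _ l3) //.
apply: ler_lim; [by apply/cvg_ex; eexists; exact: l1
  |by apply/cvg_ex; eexists; exact: l3|].
apply: nearW => k /=; rewrite -[X in _ <= X]predE -tE.
rewrite -subr_ge0 -linearB /= -mulmxBl -mulmxBr; apply/psd_tr/psd_congr.
apply: kf_update_gain_psd; apply: psdD => //; apply: psd_congr; exact: psd_kf_cov.
Qed.

Lemma steady_state_psd_tr Pi0 Pbar (B : 'M[R]_n) : psd Pi0 ->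
  steady_state_cov A C Sw Sv Pi0 Pbar -> 0 <= \tr (B *m Pbar *m B^T).
Proof.
move=> hPi0 hP.
have tE (G : 'M[R]_n) : \tr (B *m G *m B^T) = \tr ((B^T *m B) *m G).
  by rewrite mxtrace_mulC mulmxA.
have l1 := continuous_cvg eventually_filter
  (continuous_mxtrace_mul _ (B^T *m B) Pbar) hP.
rewrite tE -(cvg_lim _ l1) //.
apply: limr_ge; first by apply/cvg_ex; eexists; exact: l1.
by apply: nearW => k /=; rewrite -tE; apply/psd_tr/psd_congr; exact: psd_kf_cov.
Qed.

End Filter.

(** The new noise term joins the [Pbar] term to form a prediction step, reducing monotonicity of the
    cost to [steady_state_trace_le] with [B = A ^+ t]. *)
Lemma tr_remote_covS n (A Sw Pbar : 'M[R]_n) t :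
  \tr (remote_cov A Sw Pbar t.+1) - \tr (remote_cov A Sw Pbar t)
  = \tr (A ^+ t *m kf_predict A Sw Pbar *m (A ^+ t)^T)
    - \tr (A ^+ t *m Pbar *m (A ^+ t)^T).
Proof.
rewrite /remote_cov big_ord_recr /= -!linearB /= !trmxX; congr mxtrace.
rewrite /kf_predict mulmxDr mulmxDl exprSr -!mulmxE trmx_mul !mulmxA.
by rewrite opprD addrACA [X in _ + (X - _)]addrC addrK addrAC.
Qed.

(** * Noise energy under unstable dynamics *)

Lemma normc_real (x : R) : `|real_complex R x| = real_complex R `|x|.
Proof. by rewrite normc_def /= expr0n addr0 sqrtr_sqr. Qed.

Local Notation cmx := (map_mx (real_complex R)).

(** The trace is the squared Frobenius norm of [G]. *)
Lemma norm_entry_le n p (G : 'M[R]_(n, p)) i j e : 0 <= e ->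
  \tr (G *m G^T) <= e ^+ 2 -> `|G i j| <= e.
Proof.
move=> e0 Ge.
have E k : (G *m G^T) k k = \sum_l G k l ^+ 2.
  by rewrite mxE; apply: eq_bigr => l _; rewrite mxE expr2.
have h : G i j ^+ 2 <= e ^+ 2.
  apply: le_trans Ge; rewrite /mxtrace (bigD1 i) //= E (bigD1 j) //=.
  rewrite -addrA lerDl addr_ge0 //.
    by apply: sumr_ge0 => l _; rewrite sqr_ge0.
  apply: sumr_ge0 => k _; rewrite E.
  by apply: sumr_ge0 => l _; rewrite sqr_ge0.
by rewrite -ler_sqr ?nnegrE // real_normK // num_real.
Qed.

(* A left eigenvector of modulus >= 1 cannot annihilate Q by stabilizability,
   so the energy of A^t Q along it never decays. *)
Lemma unstable_energy n p (A : 'M[R]_n) (Q : 'M[R]_(n, p)) :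
  ~ schur_stable A -> stabilizable A Q ->
  exists2 e, 0 < e & forall t, e <= \tr ((A ^+ t *m Q) *m (A ^+ t *m Q)^T).
Proof.
move=> nA [K hK].
have [z [ez z1]] : exists z : R[i], eigenvalue (cmx A) z /\ 1 <= `|z|.
  apply: contrapT => /forallNP h; apply: nA => z ez.
  by rewrite real_ltNge ?normr_real ?real1 //; apply/negP => z1; apply: (h z).
have [v vA v0] := eigenvalueP ez; clear nA ez.
pose w := v *m cmx Q.
have w0 : w != 0.
  apply/negP => /eqP vQ.
  (* If [v] annihilated [Q], feedback through [Q] could not move the eigenvalue [z]. *)
  have : eigenvalue (cmx (A + Q *m K)) z.
    apply/eigenvalueP; exists v; last exact: v0.
    by rewrite map_mxD map_mxM mulmxDr mulmxA -/w vQ mul0mx addr0.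
  move=> /(hK z) zlt.
  by move: (lt_le_trans zlt z1); rewrite ltxx.
(* [done] would try [hK] on every goal [_ < _], and the unification diverges. *)
clear hK.
have vAt t : v *m cmx (A ^+ t *m Q) = z ^+ t *: w.
  rewrite map_mxM mulmxA /w scalemxAl; congr (_ *m _).
  elim: t => [|t IH]; first by rewrite !expr0 map_mx1 mulmx1 scale1r.
  by rewrite exprSr -mulmxE map_mxM mulmxA IH -scalemxAl vA scalerA exprSr.
clearbody w.
have [j wj] : exists j, w 0 j != 0.
  apply: contrapT => /forallNP h; move/eqP: w0; apply.
  apply/rowP => j; rewrite mxE; apply/eqP; apply: contraT => wj.
  by case: (h j).
have [D DE] : exists D, `|w 0 j| = real_complex R D.
  by rewrite normc_def; eexists.
have D0 : 0 < D by rewrite -ltcR -DE normr_gt0.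
have [V VE] : exists V, \sum_i `|v 0 i| = real_complex R V.
  exists (\sum_i Num.sqrt (complex.Re (v 0 i) ^+ 2 + complex.Im (v 0 i) ^+ 2)).
  by rewrite rmorph_sum; apply: eq_bigr => i _; rewrite normc_def.
have V0 : 0 <= V by rewrite -ler0c -VE sumr_ge0.
(* If all entries of [G] were at most [eta], coordinate [j] of [v G] would have modulus at most
   [V * eta < D], while it equals [z ^+ t * w 0 j], of modulus at least [D]. *)
pose eta := D / (V + 1).
have V1 : 0 < V + 1 by rewrite ltr_wpDl.
have eta0 : 0 < eta by rewrite divr_gt0.
have VetaD : V * eta < D.
  by rewrite /eta mulrA ltr_pdivrMr // [V * D]mulrC ltr_pM2l // ltrDl.
exists (eta ^+ 2) => [|t]; first by rewrite exprn_gt0.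
rewrite leNgt; apply/negP; set G := A ^+ t *m Q => small.
have Gle i : `|G i j| <= eta.
  exact: norm_entry_le (ltW eta0) (ltW small).
have : real_complex R D <= real_complex R (V * eta).
  rewrite -DE; apply: (@le_trans _ _ `|(v *m cmx G) 0 j|).
    rewrite vAt mxE normrM; apply: ler_peMl; first exact: normr_ge0.
    by rewrite normrX; exact: exprn_ege1.
  rewrite mxE rmorphM /= -VE mulr_suml; apply: le_trans (ler_norm_sum _ _ _) _.
  apply: ler_sum => i _; rewrite normrM; apply: ler_wpM2l; first exact: normr_ge0.
  by rewrite mxE normc_real lecR.
by rewrite lecR leNgt VetaD.
Qed.

End Covariance.

(** * Assembling the cases *)

Theorem theorem1 (R : realType) (n m : nat)
    (A : 'M[R]_n) (C : 'M[R]_(m, n))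
    (Sw : 'M[R]_n) (Sv : 'M[R]_m) (Pi0 : 'M[R]_n) (sqrtSw : 'M[R]_n)
    (hSw : psd Sw) (hSv : pd Sv) (hPi0 : psd Pi0)
    (hsqrt : is_sqrtmx sqrtSw Sw)
    (hdet : detectable A C) (hstab : stabilizable A sqrtSw)
    (Pbar : 'M[R]_n) (hPbar : steady_state_cov A C Sw Sv Pi0 Pbar)
    (r lambda : R) (hr : 0 <= r <= 1)
    (d : measure_display) (Omega : measurableType d) (P : probability Omega R)
    (gamma : nat -> {RV P >-> bool}) (hgamma : channel r gamma)
    (hnondeg : schur_stable A ->
       ~ optimal gamma (fun tau => \tr (remote_cov A Sw Pbar tau)) lambda
           never_transmit) :
  exists theta : nat,
    optimal gamma (fun tau => \tr (remote_cov A Sw Pbar tau)) lambda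
      (threshold theta).
Proof.
pose c tau := \tr (remote_cov A Sw Pbar tau).
rewrite -/c in hnondeg *.
have c_lb t : \sum_(s < t) \tr (A ^+ s *m Sw *m (A ^+ s)^T) <= c t.
  rewrite /c /remote_cov linearD /= raddf_sum /= trmxX.
  under [X in _ <= _ + X]eq_bigr do rewrite trmxX.
  rewrite lerDr; exact: (steady_state_psd_tr _ _ A C Sw Sv hSw hSv Pi0).
have c0 t : 0 <= c t.
  apply: le_trans (c_lb t); apply: sumr_ge0 => s _; exact/psd_tr/psd_congr.
have cS t : c t <= c t.+1.
  rewrite -subr_ge0 /c tr_remote_covS subr_ge0.
  exact: (steady_state_trace_le _ _ A C Sw Sv hSw hSv Pi0).
suff [theta hth] : exists theta, forall f,
    (costly_objective gamma c lambda (threshold theta)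
     <= costly_objective gamma c lambda f)%E.
  exists theta; apply/eqP; rewrite eq_le; apply/andP; split.
    by apply: le_ereal_inf_tmp => _ [f _ <-].
  by apply: ge_ereal_inf; exists (costly_objective gamma c lambda (threshold theta)).
have [l0|/ltW l0] := leP 0 lambda; last first.
  (* A nonpositive price favours transmitting, as does the monotone cost. *)
  exists 0%N => f; apply: leeD.
    apply: (le_J_e P r gamma hr hgamma) => s k; apply: (cost_homo c cS).
    (* Pathwise coupling: with the same channel outcomes, transmitting always resets whenever [f]
       does. *)
    elim: k => // k IH; rewrite !tau_at_S.
    have -> : action_at (threshold 0) s k = true by [].
    by case: (s k) => //=; rewrite andbF ltnS.
  rewrite -[lambda]opprK EFinN !mulNe leeN2.
  apply: lee_wpmul2l; first by rewrite lee_fin oppr_ge0.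
  apply: (le_J_r P r gamma hr hgamma) => s k.
  exact: leq_b1.
(* Each noise term contributes at least [e], so [c t] is at least [t * e]. *)
have c_unb : ~ schur_stable A -> forall x, exists t, x < c t.
  move=> nA x; have [e e0 he] := unstable_energy _ _ A sqrtSw nA hstab.
  have /filter_ex[t [_ ht]] := near_nat_large e (x + 1) e0.
  exists t; apply: lt_le_trans (c_lb t); have [[sQ _] QQ] := hsqrt.
  apply: (@lt_le_trans _ _ (t%:R * e)); first lra.
  rewrite -[X in X%:R]card_ord mulr_natl -sumr_const; apply: ler_sum => s _.
  by apply: le_trans (he s) _; rewrite trmx_mul sQ -QQ !mulmxA.
have [hA|nA] := pselect (schur_stable A).
  have [f0 hf0] : exists f0, (costly_objective gamma c lambda f0
      < costly_objective gamma c lambda never_transmit)%E.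
    apply: contrapT => /forallNP hn; apply: (hnondeg hA).
    apply/eqP; rewrite eq_le; apply/andP; split.
      by apply: le_ereal_inf_tmp => _ [f _ <-]; rewrite leNgt; exact/negP.
    by apply: ge_ereal_inf; exists (costly_objective gamma c lambda never_transmit).
  have J0 : (0 <= costly_objective gamma c lambda f0)%E.
    apply: adde_ge0; first exact: (J_e_ge0 P r gamma hr hgamma).
    by apply: mule_ge0; [rewrite lee_fin|exact: (J_r_ge0 P r gamma hr hgamma)].
  move: hf0 J0; case E : (costly_objective _ _ _ _) => [x| |//] hf0 _; last first.
    by move: hf0; rewrite ltNge leey.
  (* If [c] stayed below [x], never transmitting would cost at most [x], contradicting that [f0] is
     strictly better. *)
  have [t1 xt1] : exists t1, x < c t1.
    apply: contrapT => /forallNP hn; move: hf0; rewrite ltNge => /negP; apply.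
    have Jr0 : (J_r gamma never_transmit <= 0%:E)%E.
      rewrite (J_rE P r gamma hgamma); apply: limn_esup_le => e e0; apply: nearW => T.
      rewrite /mean_rate (_ : path_cost _ _ _ = fun=> 0) ?bit_mean_cst ?mulr0 ?lee_fin.
        by rewrite add0r ltW.
      by apply/funext => s; apply: big1.
    have -> : x%:E = (x%:E + lambda%:E * 0%:E)%E by rewrite mule0 adde0.
    apply: leeD; last by apply: lee_wpmul2l; rewrite ?lee_fin.
    rewrite (J_eE P r gamma hgamma); apply: limn_esup_le => e e0; apply: nearW => T.
    rewrite lee_fin /mean_rate.
    have x0 : 0 <= x by rewrite (le_trans (c0 0%N)) // leNgt; exact/negP/hn.
    apply: (@le_trans _ _ (T%:R^-1 * (T%:R * x))).
      rewrite ler_wpM2l ?invr_ge0 // -[leRHS](bit_mean_cst r T).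
      apply: ler_bit_mean => // s.
      rewrite mulr_natl -[X in _ *+ X]card_ord -sumr_const; apply: ler_sum => k _.
      by rewrite leNgt; exact/negP/hn.
    have [->|T0] := eqVneq T 0%N; first by rewrite mul0r mulr0 addr_ge0 // ltW.
    by rewrite mulKf ?pnatr_eq0 // lerDl ltW.
  apply: (exists_optimal_threshold P r gamma hr hgamma c c0 cS lambda f0 x t1) => //.
  by rewrite E.
have [[f0 hf0]|hn] := pselect (exists f0,
    (costly_objective gamma c lambda f0 < +oo)%E); last first.
  exists 0%N => f; suff -> : costly_objective gamma c lambda f = +oo%E by rewrite leey.
  by apply/eqP; rewrite -leye_eq leNgt; apply/negP => h; apply: hn; exists f.
have [x hx] : exists x, (costly_objective gamma c lambda f0 <= x%:E)%E.
  move: hf0; case: costly_objective => [x _| |_] //; first by exists x.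
  by exists 0; rewrite leNye.
have [t1 xt1] := c_unb nA x.
exact: (exists_optimal_threshold P r gamma hr hgamma c c0 cS lambda f0 x t1).
Qed.
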